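(* For every positive real number $s$, the $s$-order integral operator $J^s$ and the $s$-order derivative operator $D^s$ on $E$ satisfy $$D^sJ^s = J^sD^s = 1_E,$$ where $1_E$ is the identity operator on $E$.
   Context: $E$ is the set of infinitely differentiable functions $f:\mathbb{R}\to\mathbb{R}$ such that $f^{(k)}(x)=0$ for all $x\le 0$ and all $k\in\mathbb{N}$ (including $k=0$). For real $s>0$ and $f\in E$, $J^s(f)(x)=\frac{1}{\Gamma(s)}\int_0^x (x-y)^{s-1}f(y)\,dy$ for $x>0$ and $J^s(f)(x)=0$ for $x\le 0$; for positive integers $s$ this coincides with the $s$-fold iterate of $J^1(f)(x)=\int_0^x f(t)\,dt$. For a nonnegative integer $k$, $D^k$ is the ordinary $k$-th derivative. For real non-integer $s>0$, $D^s(f)(x)=D^kJ^{k-s}(f)(x)$, where $k$ is any chosen integer with $k>s$ (the claim is to hold for every such choice). Products of operators denote composition. *)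

(* Defs.v *)
From HB Require Import structures.
From mathcomp Require Import all_boot all_order all_algebra.
From mathcomp Require Import all_classical all_reals all_analysis.

Set Implicit Arguments.
Unset Strict Implicit.
Unset Printing Implicit Defensive.

Import Order.TTheory GRing.Theory Num.Theory.
Import numFieldNormedType.Exports.

Local Open Scope classical_set_scope.
Local Open Scope ring_scope.

Section fractional_calculus.
Context {R : realType}.
Local Notation mu := (@lebesgue_measure R).

(* [derive1n n f] is total (an underivable point gets a junk value), so
   derivability of every order is required explicitly. *)
Definition E : set (R -> R) :=
  [set f | (forall (n : nat) (x : R), derivable (derive1n n f) x 1) /\
           (forall (n : nat) (x : R), x <= 0 -> derive1n n f x = 0)].

Definition Gamma (s : R) : R :=
  \int[mu]_(t in `]0, +oo[) (t `^ (s - 1) * expR (- t)).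

(* For s < 1 the integrand is singular at y = x; it is Lebesgue integrable on
   [0, x] for f in E, and the value of [0 `^ (s - 1)] there is irrelevant. *)
Definition fracint (s : R) (f : R -> R) : R -> R := fun x =>
  if 0 < x
  then (Gamma s)^-1 * \int[mu]_(y in `[0, x]) ((x - y) `^ (s - 1) * f y)
  else 0.

(* [k] is the chosen integer k > s; it is used only for non-integer s. *)
Definition fracder (k : nat) (s : R) (f : R -> R) : R -> R :=
  if s \is a Num.nat then derive1n (Num.truncn s) f
  else derive1n k (fracint (k%:R - s) f).

End fractional_calculus.

(* Main.v *)
Require Import Defs.
From HB Require Import structures.
From mathcomp Require Import all_boot all_order all_algebra.
From mathcomp Require Import all_classical all_reals all_analysis.
From mathcomp Require Import ring lra measurable_realfun.
Import Order.TTheory GRing.Theory Num.Theory.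
Import numFieldNormedType.Exports.
Local Open Scope classical_set_scope.
Local Open Scope ring_scope.

(** Up to the factor [1 / Gamma s], the operator [J^s] is convolution with
    [g_s(u) = u^(s-1)] for [u > 0].  By scaling, [g_s * g_t = B(s,t) g_(s+t)],
    and integrating this identity against [exp(-x)] gives
    [Gamma(s) Gamma(t) = B(s,t) Gamma(s+t)]; Tonelli's theorem then yields the
    semigroup law [J^s J^t = J^(s+t)].  For [f] in [E] one has [f = J^1 f'],
    hence [J^s f = J^1 (J^s f')], which is continuous, and therefore, applying
    this to [f'], differentiable with [(J^s f)' = J^s f'].  So [J^s] preserves
    [E] and commutes with [D], and both identities reduce to [J^k D^k = 1]. *)

(** * Affine change of variables for the Lebesgue measure *)

Section affine_substitution.
Context {R : realType}.
Local Notation mu := (@lebesgue_measure R).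

Lemma measurable_affine (a b : R) :
  measurable_fun [set: R] (fun x : R => a * x + b : measurableTypeR R).
Proof. by apply: measurable_funD => //; exact: measurable_funM. Qed.

Lemma preimage_affine_itvoc (a b p q : R) : a != 0 ->
  (fun x : R => a * x + b) @^-1` `]p, q] =
  if 0 < a then `](p - b) / a, (q - b) / a]%classic
  else `[(q - b) / a, (p - b) / a[%classic.
Proof.
move=> a0; case: ifPn => a_gt0; apply/seteqP; split=> x /=; rewrite !in_itv/=.
- by rewrite ltr_pdivrMr// ler_pdivlMr// ltrBlDr lerBrDr (mulrC x).
- by rewrite ltr_pdivrMr// ler_pdivlMr// ltrBlDr lerBrDr (mulrC x).
- have a_lt0 : a < 0 by rewrite lt_neqAle a0 leNgt.
  by rewrite ler_ndivrMr// ltr_ndivlMr// ltrBlDr lerBrDr (mulrC x) andbC.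
- have a_lt0 : a < 0 by rewrite lt_neqAle a0 leNgt.
  by rewrite ler_ndivrMr// ltr_ndivlMr// ltrBlDr lerBrDr (mulrC x) andbC.
Qed.

Local Open Scope ereal_scope.

(** Uniqueness of the Lebesgue measure: the scaled pushforward gives each interval []p, q]] its
    length, since the preimage is an interval of length [(q - p) / |a|]. For [a < 0] the bracket
    changes sides, which does not affect the length. *)
Lemma lebesgue_measure_affine (a b : R) (A : set R) : (a != 0)%R ->
  measurable A ->
  mu A = `|a|%:E *
    pushforward mu (fun x : R => (a * x + b)%R : measurableTypeR R) A.
Proof.
move=> a0 mA.
pose phi : measurableTypeR R -> measurableTypeR R := fun x => (a * x + b)%R.
have mphi : measurable_fun setT phi by exact: measurable_affine.
have a_ge0 : (0 <= `|a|)%R by [].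
(* The measure structure of a pushforward depends on the measurability of the
   map, so [m0] is a function of that proof. *)
pose m0 := mscale (NngNum a_ge0) (pushforward mu phi).
pose m := m0 mphi.
rewrite (@lebesgue_measure_unique R m)//= => _ [[p q]] _ <-.
rewrite /m /m0 /mscale /= /pushforward /phi preimage_affine_itvoc//.
have [a_gt0|a_le0] := ltP 0%R a.
  rewrite !lebesgue_measure_itv/= !lte_fin ltr_pM2r ?invr_gt0// ltrD2r.
  case: ifPn => _; last by rewrite mule0.
  rewrite -EFinB -EFinM gtr0_norm//; congr EFin.
  by field.
have a_lt0 : (a < 0)%R by rewrite lt_neqAle a0.
rewrite !lebesgue_measure_itv/= !lte_fin ltr_nM2r ?invr_lt0// ltrD2r.
case: ifPn => _; last by rewrite mule0.
by rewrite -EFinB -EFinM ltr0_norm//; congr EFin; field.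
Qed.

Lemma ge0_integral_affine (a b : R) (f : R -> \bar R) : (a != 0)%R ->
  measurable_fun setT f -> (forall x, 0 <= f x) ->
  \int[mu]_x f x = `|a|%:E * \int[mu]_x f (a * x + b)%R.
Proof.
move=> a0 mf f0.
pose phi : measurableTypeR R -> measurableTypeR R := fun x => (a * x + b)%R.
have mphi : measurable_fun setT phi by exact: measurable_affine.
have a_ge0 : (0 <= `|a|)%R by [].
pose m0 := mscale (NngNum a_ge0) (pushforward mu phi).
pose m := m0 mphi.
transitivity (\int[m]_x f x).
  by apply: eq_measure_integral => A mA _; exact: lebesgue_measure_affine.
rewrite ge0_integral_mscale//=; congr (_ * _).
by rewrite ge0_integral_pushforward.
Qed.

End affine_substitution.

(** * Convolution of nonnegative extended-real functions *)

Section convolution.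
Context {R : realType}.
Local Notation mu := (@lebesgue_measure R).
Local Open Scope ereal_scope.
Implicit Types g h k : R -> \bar R.

(** Extended values let Tonelli apply to nonnegative factors before any integral is known to be
    finite. *)
Definition econv g h (x : R) : \bar R := \int[mu]_y (g (x - y)%R * h y).

Lemma econv_ge0 g h x : (forall u, 0 <= g u) -> (forall u, 0 <= h u) ->
  0 <= econv g h x.
Proof. by move=> g0 h0; apply: integral_ge0 => y _; exact: mule_ge0. Qed.

Lemma measurable_fun_comp_sub2 g : measurable_fun setT g ->
  measurable_fun [set: measurableTypeR R * measurableTypeR R]
    (fun p : measurableTypeR R * measurableTypeR R => g (p.1 - p.2)%R).
Proof.
move=> mg; apply: (@measurableT_comp _ _ _ _ _ _ g) => //.
by apply: measurable_funB; [exact: measurable_fst|exact: measurable_snd].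
Qed.

Lemma measurable_fun_comp_subl g (x : R) : measurable_fun setT g ->
  measurable_fun setT (fun y : R => g (x - y)%R).
Proof.
move=> mg; apply: (@measurableT_comp _ _ _ _ _ _ g) => //.
exact: measurable_funB.
Qed.

Lemma measurable_econv_integrand g h (x : R) : measurable_fun setT g ->
  measurable_fun setT h ->
  measurable_fun setT (fun y : R => g (x - y)%R * h y).
Proof.
move=> mg mh; apply: emeasurable_funM => //; exact: measurable_fun_comp_subl.
Qed.

Lemma measurable_fun_comp_subr g (x : R) : measurable_fun setT g ->
  measurable_fun setT (fun y : R => g (y - x)%R).
Proof.
move=> mg; apply: (@measurableT_comp _ _ _ _ _ _ g) => //.
exact: measurable_funB.
Qed.

Lemma measurable_econv g h : measurable_fun setT g -> measurable_fun setT h ->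
  (forall u, 0 <= g u) -> (forall u, 0 <= h u) ->
  measurable_fun setT (econv g h).
Proof.
move=> mg mh g0 h0.
apply: (@measurable_fun_fubini_tonelli_F _ _ (measurableTypeR R)
  (measurableTypeR R) R mu
  (fun p : measurableTypeR R * measurableTypeR R => g (p.1 - p.2)%R * h p.2)).
  apply: emeasurable_funM; first exact: measurable_fun_comp_sub2.
  by apply: (@measurableT_comp _ _ _ _ _ _ h) => //; exact: measurable_snd.
by move=> p; exact: mule_ge0.
Qed.

Lemma ge0_integral_shift g (a : R) : measurable_fun setT g ->
  (forall u, 0 <= g u) -> \int[mu]_x g (x - a)%R = \int[mu]_x g x.
Proof.
move=> mg g0; rewrite [RHS](@ge0_integral_affine _ 1 (- a))//.
by rewrite normr1 mul1e; under [RHS]eq_integral do rewrite mul1r.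
Qed.

Lemma ge0_integral_reflect g (a : R) : measurable_fun setT g ->
  (forall u, 0 <= g u) -> \int[mu]_x g (a - x)%R = \int[mu]_x g x.
Proof.
move=> mg g0; rewrite [RHS](@ge0_integral_affine _ (-1) a)//.
rewrite normrN1 mul1e; apply: eq_integral => x _.
by rewrite mulN1r addrC.
Qed.

(** Tonelli exchanges the two integrals; for fixed [z], translating [y] by [z] turns the inner one
    into a convolution at [x - z]. *)
Lemma econvA g h k : measurable_fun setT g -> measurable_fun setT h ->
  measurable_fun setT k -> (forall u, 0 <= g u) -> (forall u, 0 <= h u) ->
  (forall u, 0 <= k u) -> econv g (econv h k) = econv (econv g h) k.
Proof.
move=> mg mh mk g0 h0 k0; apply/funext => x; rewrite /econv.
transitivity (\int[mu]_y \int[mu]_z (g (x - y)%R * (h (y - z)%R * k z))).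
  apply: eq_integral => y _; rewrite ge0_integralZl//.
    exact: measurable_econv_integrand.
  by move=> z _; exact: mule_ge0.
rewrite (@fubini_tonelli _ _ (measurableTypeR R) (measurableTypeR R) R mu mu
  (fun p : measurableTypeR R * measurableTypeR R =>
     g (x - p.1)%R * (h (p.1 - p.2)%R * k p.2))); last 2 first.
- apply: emeasurable_funM.
    apply: (@measurableT_comp _ _ _ _ _ _ g) => //.
    by apply: measurable_funB => //; exact: measurable_fst.
  apply: emeasurable_funM; first exact: measurable_fun_comp_sub2.
  by apply: (@measurableT_comp _ _ _ _ _ _ k) => //; exact: measurable_snd.
- by move=> p; rewrite !mule_ge0.
apply: eq_integral => z _ /=.
under eq_integral do rewrite muleA.
rewrite ge0_integralZr//; last 2 first.
- apply: emeasurable_funM; first exact: measurable_fun_comp_subl.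
  exact: measurable_fun_comp_subr.
- by move=> y _; rewrite mule_ge0.
congr (_ * _).
rewrite -[RHS](@ge0_integral_shift _ z); last 2 first.
- exact: measurable_econv_integrand.
- by move=> y; rewrite mule_ge0.
apply: eq_integral => y _; congr (g _ * _); ring.
Qed.

(** After Tonelli, translation invariance makes the inner integral a constant. *)
Lemma integral_econv g h : measurable_fun setT g -> measurable_fun setT h ->
  (forall u, 0 <= g u) -> (forall u, 0 <= h u) ->
  \int[mu]_x econv g h x = \int[mu]_x g x * \int[mu]_x h x.
Proof.
move=> mg mh g0 h0; rewrite /econv.
rewrite (@fubini_tonelli _ _ (measurableTypeR R) (measurableTypeR R) R mu mu
  (fun p : measurableTypeR R * measurableTypeR R =>
     g (p.1 - p.2)%R * h p.2)); last 2 first.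
- apply: emeasurable_funM; first exact: measurable_fun_comp_sub2.
  by apply: (@measurableT_comp _ _ _ _ _ _ h) => //; exact: measurable_snd.
- by move=> p; rewrite !mule_ge0.
under eq_integral => y _ /=.
  rewrite ge0_integralZr//; last exact: measurable_fun_comp_subr.
  rewrite ge0_integral_shift//.
  over.
by rewrite ge0_integralZl//; exact: integral_ge0.
Qed.

End convolution.

(** * The power kernel, with the Beta and Gamma integrals *)

Section kernel.
Context {R : realType}.
Local Notation mu := (@lebesgue_measure R).
Implicit Types s t u w x y : R.

(* The kernel is [0] at [u = 0], so that [econv_rlker] holds everywhere. *)
Definition rlker s u : R := if 0 < u then u `^ (s - 1) else 0.

Lemma rlker_ge0 s u : 0 <= rlker s u.
Proof. by rewrite /rlker; case: ifP => // _; exact: powR_ge0. Qed.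

Lemma measurable_rlker s : measurable_fun [set: R] (rlker s).
Proof.
by apply: measurable_fun_ifT => //; exact: measurable_fun_ltr.
Qed.

Lemma measurable_rlker_EFin s : measurable_fun [set: R] (EFin \o rlker s).
Proof. by apply/measurable_EFinP; exact: measurable_rlker. Qed.

Lemma rlker_scale s w u : 0 < w -> rlker s (w * u) = w `^ (s - 1) * rlker s u.
Proof.
move=> w0; rewrite /rlker pmulr_rgt0//.
by case: ifPn => u0; rewrite ?mulr0// powRM// ltW.
Qed.

Local Open Scope ereal_scope.

(** Euler's Beta integral: both kernels are nonzero only for [0 < y < 1], where the integrand is
    [(1 - y)^(s-1) y^(t-1)]. *)
Definition ebeta s t : \bar R := econv (EFin \o rlker s) (EFin \o rlker t) 1%R.

Lemma ebeta_ge0 s t : 0 <= ebeta s t.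
Proof. by apply: econv_ge0 => u; rewrite lee_fin rlker_ge0. Qed.

(** For [x > 0], the substitution of [x * y] for [y] and the homogeneity of the kernels pull out all
    dependence on [x]. *)
Lemma econv_rlker s t x :
  econv (EFin \o rlker s) (EFin \o rlker t) x =
  ebeta s t * (rlker (s + t) x)%:E.
Proof.
have [x0|x0] := leP x 0%R.
  (* A nonzero integrand would force [0 < y < x], impossible for [x <= 0]. *)
  rewrite /rlker (le_gtF x0) mule0 /econv; apply: integral0_eq => y _ /=.
  rewrite -EFinM /rlker; case: ifPn => xy; rewrite ?mul0r//.
  case: ifPn => y0; rewrite ?mulr0//.
  by move: xy; rewrite subr_gt0 => /(lt_trans y0); rewrite ltNge x0.
rewrite {1}/econv (@ge0_integral_affine _ x 0); last 3 first.
- by rewrite gt_eqF.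
- by apply: (@measurable_econv_integrand _ (EFin \o rlker s) (EFin \o rlker t));
    exact: measurable_rlker_EFin.
- by move=> y; rewrite mule_ge0// lee_fin rlker_ge0.
under eq_integral => y _.
  rewrite /= addr0 -[X in (X - _)%R]mulr1 -mulrBr !rlker_scale//.
  rewrite -EFinM mulrACA EFinM [X in _ * X]EFinM.
  over.
rewrite /= ge0_integralZl//; last 3 first.
- by apply: (@measurable_econv_integrand _ (EFin \o rlker s) (EFin \o rlker t));
    exact: measurable_rlker_EFin.
- by move=> y _; rewrite mule_ge0// lee_fin rlker_ge0.
- by rewrite lee_fin mulr_ge0// powR_ge0.
rewrite muleA [RHS]muleC; congr (_ * _).
rewrite -EFinM gtr0_norm//; congr EFin.
rewrite /rlker x0 -powRD; last by rewrite (gt_eqF x0) implybT.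
(* The Jacobian [x] is written [x^1] to add its exponent to [s - 1] and [t - 1]. *)
rewrite -{1}(powRr1 (ltW x0)) -powRD; last by rewrite (gt_eqF x0) implybT.
by congr (_ `^ _)%R; ring.
Qed.

(** The Gamma integral before [fine] is applied, so that product identities can precede
    finiteness. *)
Definition egamma s : \bar R := \int[mu]_x (rlker s x * expR (- x))%:E.

Lemma measurable_rlker_expR s :
  measurable_fun [set: R] (fun x => rlker s x * expR (- x))%R.
Proof.
apply: measurable_funM; first exact: measurable_rlker.
by apply: measurableT_comp => //; exact: measurable_funN.
Qed.

Lemma egammaE s :
  egamma s = \int[mu]_(t in `]0%R, +oo[) (t `^ (s - 1) * expR (- t))%:E.
Proof.
rewrite [RHS]integral_mkcond; apply: eq_integral => x _.
rewrite /rlker patchE mem_setE in_itv/= andbT.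
by case: ifP => //; rewrite mul0r.
Qed.

Lemma GammaE s : Gamma s = fine (egamma s).
Proof. by rewrite egammaE. Qed.

(** Since [exp(-(x - y)) exp(-y) = exp(-x)], convolving the two damped kernels gives the damped
    convolution of the kernels; integrate over [x]. *)
Lemma egammaM s t : egamma s * egamma t = ebeta s t * egamma (s + t).
Proof.
pose g s x := (rlker s x * expR (- x))%:E.
have g0 r x : 0 <= g r x by rewrite lee_fin mulr_ge0 ?rlker_ge0 ?expR_ge0.
have mg r : measurable_fun setT (g r).
  by apply/measurable_EFinP; exact: measurable_rlker_expR.
rewrite -(@integral_econv _ (g s) (g t))//.
rewrite -[egamma (s + t)]/(\int[mu]_x g (s + t)%R x).
rewrite -ge0_integralZl ?ebeta_ge0//; last exact: mg.
apply: eq_integral => x _.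
rewrite /g [in RHS]EFinM muleA -econv_rlker /econv.
rewrite -ge0_integralZr//; last 2 first.
- by apply: (@measurable_econv_integrand _ (EFin \o rlker s) (EFin \o rlker t));
    exact: measurable_rlker_EFin.
- by move=> y _; rewrite mule_ge0// lee_fin rlker_ge0.
apply: eq_integral => y _; rewrite /g /= -!EFinM; congr EFin.
rewrite mulrACA -expRD; congr (_ * expR _)%R; ring.
Qed.

(** On [[1, 2]] one has [0 <= ln x <= 1], so the integrand is at least [exp(-|s - 1| - 2)] there. *)
Lemma egamma_gt0 s : 0 < egamma s.
Proof.
pose c := expR (- `|s - 1| - 2)%R.
apply: (@lt_le_trans _ _ (\int[mu]_(x in `[1%R, 2%R]) c%:E)).
  rewrite integral_cst//= lebesgue_measure_itv/= lte_fin ifT ?ltr1n//.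
  by rewrite -EFinB -EFinM lte_fin mulr_gt0 ?expR_gt0//; lra.
apply: (@le_trans _ _
    (\int[mu]_(x in `[1%R, 2%R]) (rlker s x * expR (- x))%:E)); last first.
  apply: ge0_subset_integral => //.
    by apply/measurable_EFinP; exact: measurable_rlker_expR.
  by move=> x _; rewrite lee_fin mulr_ge0 ?rlker_ge0 ?expR_ge0.
apply: ge0_le_integral => //=.
- by move=> x _; rewrite lee_fin expR_ge0.
- by apply/measurable_EFinP/measurable_funTS; exact: measurable_rlker_expR.
move=> x; rewrite in_itv/= => /andP[x1 x2].
have x0 : (0 < x)%R by exact: lt_le_trans x1.
rewrite lee_fin /rlker x0 /powR gt_eqF// -expRD ler_expR.
have lnx0 : (0 <= ln x)%R by exact: ln_ge0.
have lnx1 : (ln x <= 1)%R.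
  have := @le_ln1Dx R (x - 1)%R; rewrite subrKC => /(_ _)/le_trans; apply.
    by rewrite ltrBrDr addNr.
  by rewrite lerBlDr.
have h1 : (- `|s - 1| <= (s - 1) * ln x)%R.
  apply: (@le_trans _ _ (- (`|s - 1| * ln x))%R).
    by rewrite lerN2 ler_piMr.
  by rewrite -mulNr ler_wpM2r// lerNl (le_trans (ler_norm _))// normrN.
by rewrite lerD// lerN2.
Qed.

End kernel.

(** * Finiteness of the Gamma integral and the Beta-Gamma relation *)

Section gamma_finite.
Context {R : realType}.
Local Notation mu := (@lebesgue_measure R).
Implicit Types s t u w x y : R.

Lemma continuous_powR s x : 0 < x -> {for x, continuous (@powR R ^~ s)}.
Proof.
move=> x0; apply: differentiable_continuous; apply/derivable1_diffP.
by apply: derivable_powR; rewrite in_itv/= x0.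
Qed.

Lemma integral_powR_itvcc s a : 0 < s -> 0 < a -> a < 1 ->
  (\int[mu]_(x in `[a, 1%R]) (x `^ (s - 1))%:E = (s^-1 * (1 - a `^ s))%:E)%E.
Proof.
move=> s0 a0 a1.
have pos x : a <= x -> 0 < x by exact: lt_le_trans.
have cf r : {within `[a, 1], continuous (fun x : R => x `^ r)}.
  apply: continuous_in_subspaceT => x; rewrite inE/= in_itv/= => /andP[ax _].
  by apply: continuous_powR; exact: pos.
rewrite (@continuous_FTC2 _ _ (fun x => s^-1 * x `^ s))//; first last.
- move=> x; rewrite in_itv/= => /andP[/ltW/pos x0 _].
  rewrite derive1E deriveM//; last first.
    by apply: derivable_powR; rewrite in_itv/= x0.
  have [_ ->] := is_derive1_powR s x0.
  by rewrite derive_cst scaler0 addr0 /GRing.scale/= mulKf// gt_eqF.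
- split.
  + move=> x; rewrite in_itv/= => /andP[/ltW/pos x0 _].
    apply: derivableM => //; apply: derivable_powR; by rewrite in_itv/= x0.
  + apply: cvg_at_right_filter; apply: cvgM; first exact: cvg_cst.
    exact: continuous_powR.
  + apply: cvg_at_left_filter; apply: cvgM; first exact: cvg_cst.
    exact: continuous_powR.
by rewrite powR1 -EFinB -mulrBr.
Qed.

(** Monotone convergence along compact intervals avoiding the singularity at [0], on which the
    integrals stay below [1 / s]. *)
Lemma integral_powR_lty s : 0 < s ->
  (\int[mu]_(x in `]0%R, 1%R]) (x `^ (s - 1))%:E < +oo)%E.
Proof.
move=> s0.
(* Starting at [1 / 2] keeps every left endpoint strictly below [1], as [integral_powR_itvcc]
   demands. *)
pose F n : set (measurableTypeR R) := `[n.+2%:R^-1 : R, 1%R]%classic.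
have FU : \bigcup_n F n = `]0%R, 1%R]%classic :> set R.
  apply/seteqP; split=> x /=.
    move=> [n _]; rewrite /F /= !in_itv/= => /andP[nx ->]; rewrite andbT.
    by apply: lt_le_trans nx; rewrite invr_gt0.
  rewrite in_itv/= => /andP[x0 x1].
  exists (Num.truncn x^-1) => //; rewrite /F/= in_itv/= x1 andbT.
  rewrite invf_ple ?posrE//.
  rewrite (le_trans (ltW (truncnS_gt _)))// ler_nat.
  by rewrite ltnS.
rewrite -FU.
have Fcvg : (\int[mu]_(x in F i) (x `^ (s - 1))%:E @[i --> \oo] -->
    \int[mu]_(x in \bigcup_i F i) (x `^ (s - 1))%:E)%E.
  apply: ge0_nondecreasing_set_cvg_integral.
  - apply/nondecreasing_seqP => n; apply/subsetPset; apply: subset_itvr.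
    by rewrite bnd_simp lef_pV2 ?posrE// ler_nat.
  - by move=> n; exact: measurable_itv.
  - move=> n; apply: measurable_funTS; apply/measurable_EFinP.
    exact: measurable_powR.
  - by move=> n x _; rewrite lee_fin powR_ge0.
apply: (@le_lt_trans _ _ (s^-1)%:E); last by rewrite ltry.
rewrite -(cvg_lim _ Fcvg)//; apply: lime_le.
  by apply/cvg_ex; eexists; exact: Fcvg.
apply: nearW => n; rewrite integral_powR_itvcc ?invr_gt0//; last first.
  by rewrite invf_lt1// ltr1n.
by rewrite lee_fin ler_piMr ?invr_ge0 ?ltW// lerBlDr lerDl powR_ge0.
Qed.

(** Half of the exponential absorbs the power, because the logarithm is sublinear. *)
Lemma powR_expR_bound s : exists2 K : R, 0 <= K &
  forall x, 1 <= x -> x `^ (s - 1) * expR (- x) <= K * expR (- 2^-1 * x).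
Proof.
(* [c] is chosen so that [p / c <= 1 / 2]: then [ln (x / c) <= x / c] gives
   [p ln x <= p ln c + x / 2]. The [+ 1] keeps [c] positive when [s = 1]. *)
pose p := `|s - 1|; pose c := 2 * (p + 1).
have p0 : 0 <= p by exact: normr_ge0.
have c0 : 0 < c by rewrite /c; lra.
exists (expR (p * ln c)); first exact: expR_ge0.
move=> x x1; have x0 : 0 < x by exact: lt_le_trans x1.
rewrite /powR gt_eqF// -!expRD ler_expR.
have lx0 : 0 <= ln x by exact: ln_ge0.
have h1 : (s - 1) * ln x <= p * ln x by rewrite ler_wpM2r// ler_norm.
have h2 : ln x - ln c <= x / c.
  by rewrite -ln_div ?posrE//; apply/ltW/ln_sublinear; rewrite divr_gt0.
have h3 : p * (ln x - ln c) <= 2^-1 * x.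
  apply: (le_trans (ler_wpM2l p0 h2)).
  rewrite mulrCA mulrC ler_wpM2r ?ltW//.
  rewrite ltr_pdivrMr// /c; lra.
lra.
Qed.

(** The integrand is split at [1]: below, the power dominates it; above, a multiple of the
    exponential density of rate [1 / 2] does, whose total mass is [1]. *)
Lemma egamma_lty s : 0 < s -> (egamma s < +oo)%E.
Proof.
move=> s0; have [K K0 hK] := powR_expR_bound s.
pose f1 x : \bar R := ((fun x : R => (x `^ (s - 1))%:E) \_ `]0%R, 1%R]) x.
(* The factor [2] cancels the rate [1 / 2] in front of the density. *)
pose f2 x : \bar R := ((2 * K)%:E * (exponential_pdf 2^-1 x)%:E)%E.
have f10 x : (0 <= f1 x)%E.
  by rewrite /f1; apply: erestrict_ge0 => y _; rewrite lee_fin powR_ge0.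
have f20 x : (0 <= f2 x)%E.
  rewrite /f2 -EFinM lee_fin mulr_ge0// ?mulr_ge0//.
  exact: exponential_pdf_ge0.
have mf1 : measurable_fun [set: R] f1.
  apply/(measurable_restrictT _ _).1 => //; apply: measurable_funTS.
  by apply/measurable_EFinP; exact: measurable_powR.
have mf2 : measurable_fun [set: R] f2.
  apply: emeasurable_funM => //; apply/measurable_EFinP.
  exact: measurable_exponential_pdf.
apply: (@le_lt_trans _ _ (\int[mu]_x (f1 x + f2 x))%E).
  apply: ge0_le_integral => //=.
  - by move=> x _; rewrite lee_fin mulr_ge0 ?rlker_ge0 ?expR_ge0.
  - by apply/measurable_EFinP; exact: measurable_rlker_expR.
  - exact: emeasurable_funD.
  move=> x _; rewrite /rlker; case: ifPn => x0; last first.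
    by rewrite mul0r adde_ge0.
  have [x1|x1] := leP x 1.
    apply: (@le_trans _ _ (f1 x)); last by rewrite leeDl.
    rewrite /f1 patchE mem_setE in_itv/= x0 x1 lee_fin ler_piMr ?powR_ge0//.
    by rewrite expR_le1 oppr_le0 ltW.
  apply: (@le_trans _ _ (f2 x)); last by rewrite leeDr.
  rewrite /f2 -EFinM lee_fin (le_trans (hK _ (ltW x1)))//.
  rewrite exponential_pdfE; last exact: ltW.
  lra.
rewrite ge0_integralD// lte_add_pinfty//.
  by rewrite /f1 -integral_mkcond; exact: integral_powR_lty.
rewrite /f2 ge0_integralZl//; last 3 first.
- by apply/measurable_EFinP; exact: measurable_exponential_pdf.
- by move=> x _; rewrite lee_fin exponential_pdf_ge0.
- by rewrite lee_fin mulr_ge0.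
by rewrite integral_exponential_pdf// mule1 ltry.
Qed.

Lemma egamma_fin_num s : 0 < s -> egamma s \is a fin_num.
Proof. by move=> s0; rewrite ge0_fin_numE ?egamma_lty// ltW// egamma_gt0. Qed.

Lemma EFin_Gamma s : 0 < s -> ((Gamma s)%:E = egamma s)%E.
Proof. by move=> s0; rewrite GammaE fineK// egamma_fin_num. Qed.

Lemma Gamma_gt0 s : 0 < s -> 0 < Gamma s.
Proof. by move=> s0; rewrite -lte_fin EFin_Gamma// egamma_gt0. Qed.

(** The integrand is the exponential density of rate [1], up to the null point [0]. *)
Lemma Gamma1 : Gamma 1 = 1 :> R.
Proof.
rewrite GammaE egammaE integral_itv_obnd_cbnd; last first.
  apply: measurable_funTS; apply/measurable_EFinP; apply: measurable_funM.
    exact: measurable_powR.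
  by apply: measurableT_comp => //; exact: measurable_funN.
rewrite -[RHS]/(fine 1%:E) -(@integral_exponential_pdf R 1)//; congr fine.
rewrite [LHS]integral_mkcond; apply: eq_integral => x _.
rewrite /exponential_pdf !patchE; case: ifP => // _.
by rewrite subrr powRr0 mulN1r.
Qed.

Lemma ebetaE s t : 0 < s -> 0 < t ->
  ebeta s t = (Gamma s * Gamma t / Gamma (s + t))%:E.
Proof.
move=> s0 t0; have st0 := addr_gt0 s0 t0.
have := egammaM s t; rewrite -!EFin_Gamma// -EFinM.
have g0 := Gamma_gt0 _ st0.
case: (ebeta s t) (ebeta_ge0 s t) => [r _||//].
- by rewrite -EFinM => -[->]; rewrite mulfK// gt_eqF.
(* An infinite Beta value would make the finite product [Gamma s * Gamma t] infinite. *)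
- by rewrite gt0_mulye// lte_fin.
Qed.

End gamma_finite.

(** * The semigroup law for fractional integrals *)

Section semigroup.
Context {R : realType}.
Local Notation mu := (@lebesgue_measure R).
Implicit Types (s t x y b M : R) (f g h : R -> R).

(** A class wider than [E], closed under positive and negative parts, which need not be smooth, and
    under [fracint s] for [s > 0]. Growth at [+oo] is unrestricted. *)
Definition causal f := [/\ measurable_fun [set: R] f,
  forall x, x <= 0 -> f x = 0 &
  forall b, exists M, forall y, y <= b -> `|f y| <= M].

Lemma causalB f g : causal f -> causal g -> causal (fun x => f x - g x).
Proof.
move=> [mf f0 bf] [mg g0 bg]; split.
- exact: measurable_funB.
- by move=> x x0; rewrite f0// g0// subrr.
move=> b; have [M hM] := bf b; have [N hN] := bg b.
exists (M + N) => y yb; rewrite (le_trans (ler_normB _ _))// lerD//.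
  exact: hM.
exact: hN.
Qed.

Lemma causal_funrpos f : causal f -> causal (f^\+).
Proof.
move=> [mf f0 bf]; split.
- exact: measurable_funrpos.
- by move=> x x0; rewrite /funrpos f0// maxxx.
move=> b; have [M hM] := bf b; exists M => y yb.
rewrite ger0_norm ?funrpos_ge0// (le_trans _ (hM _ yb))// /funrpos.
by rewrite ge_max ler_norm normr_ge0.
Qed.

Lemma causal_funrneg f : causal f -> causal (f^\-).
Proof.
move=> [mf f0 bf]; split.
- exact: measurable_funrneg.
- by move=> x x0; rewrite /funrneg f0// oppr0 maxxx.
move=> b; have [M hM] := bf b; exists M => y yb.
rewrite ger0_norm ?funrneg_ge0// (le_trans _ (hM _ yb))// /funrneg.
by rewrite ge_max normr_ge0 -normrN ler_norm.
Qed.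

(* On the support [0 < z < x] of the integrand,
   [1 <= expR b * expR (- (x - z))]. *)
Lemma econv_rlker_le s f x b M : 0 < s -> causal f -> x <= b ->
  (forall y, y <= b -> `|f y| <= M) ->
  (econv (EFin \o rlker s) (fun y => `|f y|%:E) x <=
   (M * expR b * Gamma s)%:E)%E.
Proof.
move=> s0 [mf f0 _] xb hM.
have M0 : 0 <= M by apply: le_trans (hM _ xb).
have mk : measurable_fun [set: R] (fun y => (rlker s y * expR (- y))%:E).
  by apply/measurable_EFinP; exact: measurable_rlker_expR.
have k0 y : (0 <= (rlker s y * expR (- y))%:E)%E.
  by rewrite lee_fin mulr_ge0 ?rlker_ge0 ?expR_ge0.
rewrite EFinM EFin_Gamma// /egamma.
rewrite -(@ge0_integral_reflect _ _ x mk k0) -ge0_integralZl//; last 2 first.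
- exact: (measurable_fun_comp_subl _ _ mk).
- by rewrite lee_fin mulr_ge0 ?expR_ge0.
apply: ge0_le_integral => //=.
- by move=> y _; rewrite -EFinM lee_fin mulr_ge0 ?rlker_ge0.
- apply: (@measurable_econv_integrand _ (EFin \o rlker s)).
    exact: measurable_rlker_EFin.
  by apply/measurable_EFinP; exact: measurableT_comp.
- apply: emeasurable_funM => //; exact: (measurable_fun_comp_subl _ _ mk).
move=> y _; rewrite -!EFinM lee_fin.
rewrite /rlker; case: ifPn => xy; last by rewrite !mul0r mulr0.
have [y0|y0] := leP y 0.
  by rewrite f0// normr0 mulr0 !mulr_ge0 ?expR_ge0 ?powR_ge0.
have yb : y <= b by rewrite (le_trans _ xb)// ltW// -subr_gt0.
rewrite mulrCA ler_wpM2l ?powR_ge0// -mulrA -expRD.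
rewrite (le_trans (hM _ yb))// ler_peMr// -expR0 ler_expR.
by rewrite subr_ge0 lerBlDr (le_trans xb)// lerDl ltW.
Qed.

Lemma integrable_rlker s f x : 0 < s -> causal f ->
  mu.-integrable [set: R] (EFin \o (fun y => rlker s (x - y) * f y)).
Proof.
move=> s0 cf; have [mf _ /(_ x)[M hM]] := cf.
apply/integrableP; split.
  apply/measurable_EFinP; apply: measurable_funM => //.
  apply: (@measurableT_comp _ _ _ _ _ _ (rlker s)).
    exact: measurable_rlker.
  exact: measurable_funB.
apply: (@le_lt_trans _ _ (M * expR x * Gamma s)%:E); last by rewrite ltry.
rewrite (le_trans _ (econv_rlker_le s f x x M s0 cf (lexx _) hM))//.
rewrite le_eqVlt; apply/orP; left; apply/eqP; apply: eq_integral => y _ /=.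
by rewrite normrM (ger0_norm (rlker_ge0 _ _)) EFinM.
Qed.

(** The whole-line form makes the operator a convolution: the kernel cuts off [y >= x], and [f]
    vanishes for [y <= 0]. *)
Lemma fracintE s f x : 0 < s -> causal f ->
  fracint s f x = (Gamma s)^-1 * \int[mu]_y (rlker s (x - y) * f y).
Proof.
move=> s0 cf; have [mf f0 _] := cf.
rewrite /fracint; case: ifPn => x0; last first.
  rewrite /Rintegral integral0_eq ?mulr0// => y _; congr EFin.
  rewrite /rlker subr_gt0; case: ifPn => yx; last by rewrite mul0r.
  by rewrite f0 ?mulr0// (le_trans (ltW yx))// leNgt.
congr (_ * fine _).
(* The null endpoint [y = x] is dropped because for [s = 1] the power there is [0^0 = 1], while
   [rlker] is [0]. *)
rewrite -integral_itv_bndo_bndc; last first.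
  apply: measurable_funTS; apply/measurable_EFinP; apply: measurable_funM => //.
  apply: (@measurableT_comp _ _ _ _ _ _ (@powR R ^~ (s - 1))).
    exact: measurable_powR.
  exact: measurable_funB.
rewrite [LHS]integral_mkcond; apply: eq_integral => y _.
rewrite patchE mem_setE in_itv/= /rlker subr_gt0.
have [y0/=|y0/=] := leP 0 y; first by case: ifP; rewrite ?mul0r.
by rewrite f0 ?mulr0// ltW.
Qed.

Lemma fracintB s f g : 0 < s -> causal f -> causal g ->
  fracint s (fun x => f x - g x) = (fun x => fracint s f x - fracint s g x).
Proof.
move=> s0 cf cg; apply/funext => x.
rewrite !fracintE//; last exact: causalB.
rewrite -mulrBr -RintegralB//; last 2 first.
- exact: integrable_rlker.
- exact: integrable_rlker.
by congr (_ * _); apply: eq_Rintegral => y _; rewrite mulrBr.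
Qed.

Lemma EFin_fracint s f x : 0 < s -> causal f -> (forall y, 0 <= f y) ->
  ((fracint s f x)%:E =
   (Gamma s)^-1%:E * econv (EFin \o rlker s) (EFin \o f) x)%E.
Proof.
move=> s0 cf f0; rewrite fracintE// EFinM; congr (_ * _)%E.
rewrite /Rintegral fineK; first by apply: eq_integral => y _; rewrite EFinM.
by apply: integrable_fin_num => //; exact: integrable_rlker.
Qed.

Lemma fracint_ge0 s f x : 0 < s -> causal f -> (forall y, 0 <= f y) ->
  0 <= fracint s f x.
Proof.
move=> s0 cf f0; rewrite fracintE// mulr_ge0//.
  by rewrite invr_ge0 ltW// Gamma_gt0.
by apply: Rintegral_ge0 => y _; rewrite mulr_ge0 ?rlker_ge0.
Qed.

Lemma fracint_le0 s f x : x <= 0 -> fracint s f x = 0.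
Proof. by move=> x0; rewrite /fracint ltNge x0. Qed.

(** Measurability comes from Tonelli through [measurable_econv]; in the bound from [econv_rlker_le],
    [Gamma s] cancels and [M * expR b] remains. *)
Lemma causal_fracint_ge0 s f : 0 < s -> causal f -> (forall y, 0 <= f y) ->
  causal (fracint s f).
Proof.
move=> s0 cf f0; split.
- apply/measurable_EFinP.
  have -> : EFin \o fracint s f = (fun x =>
      (Gamma s)^-1%:E * econv (EFin \o rlker s) (EFin \o f) x)%E.
    by apply/funext => x /=; rewrite EFin_fracint.
  apply: emeasurable_funM => //; apply: measurable_econv.
  + exact: measurable_rlker_EFin.
  + by apply/measurable_EFinP; case: cf.
  + by move=> u; rewrite lee_fin rlker_ge0.
  + by move=> u; rewrite lee_fin.
- by move=> x; exact: fracint_le0.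
move=> b; have [_ _ /(_ b)[M hM]] := cf.
exists (M * expR b) => y yb; rewrite ger0_norm ?fracint_ge0//.
rewrite -lee_fin EFin_fracint//.
have := econv_rlker_le s f y b M s0 cf yb hM.
have -> : (fun y => `|f y|%:E) = EFin \o f.
  by apply/funext => z; rewrite /= ger0_norm.
have g0 := Gamma_gt0 _ s0.
move=> /(@lee_wpmul2l _ (Gamma s)^-1%:E) h; apply: (le_trans (h _)).
  by rewrite lee_fin invr_ge0 ltW.
by rewrite -EFinM lee_fin mulrC mulfK// gt_eqF.
Qed.

Lemma funrpos_neg f : f = (fun x => f^\+ x - f^\- x).
Proof. by rewrite -[LHS]funrposBneg. Qed.

Lemma causal_fracint s f : 0 < s -> causal f -> causal (fracint s f).
Proof.
move=> s0 cf; have cp := causal_funrpos _ cf; have cn := causal_funrneg _ cf.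
rewrite (funrpos_neg f) fracintB//; apply: causalB.
  by apply: causal_fracint_ge0 => //; exact: funrpos_ge0.
by apply: causal_fracint_ge0 => //; exact: funrneg_ge0.
Qed.

(** Associativity brings the two kernels together; their Beta factor turns [1 / (Gamma s * Gamma t)]
    into [1 / Gamma (s + t)]. *)
Lemma fracint_semigroup_ge0 s t f : 0 < s -> 0 < t -> causal f ->
  (forall y, 0 <= f y) -> fracint s (fracint t f) = fracint (s + t) f.
Proof.
move=> s0 t0 cf f0; apply/funext => x; apply: EFin_inj.
have st0 := addr_gt0 s0 t0.
have ct : causal (fracint t f) by exact: causal_fracint_ge0.
have ft0 y : 0 <= fracint t f y by exact: fracint_ge0.
have mk r := @measurable_rlker_EFin R r.
have k0 r u : (0 <= (EFin \o rlker r) u :> \bar R)%E.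
  by rewrite lee_fin rlker_ge0.
have mf : measurable_fun setT (EFin \o f).
  by apply/measurable_EFinP; case: cf.
rewrite !EFin_fracint//.
have -> : EFin \o fracint t f = (fun x =>
    (Gamma t)^-1%:E * econv (EFin \o rlker t) (EFin \o f) x)%E.
  by apply/funext => y /=; rewrite EFin_fracint.
have gs := Gamma_gt0 _ s0; have gt := Gamma_gt0 _ t0.
have gst := Gamma_gt0 _ st0.
have -> : (econv (EFin \o rlker s) (fun x =>
    (Gamma t)^-1%:E * econv (EFin \o rlker t) (EFin \o f) x) x =
   (Gamma t)^-1%:E *
    econv (EFin \o rlker s) (econv (EFin \o rlker t) (EFin \o f)) x)%E.
  rewrite {1}/econv.
  under eq_integral do rewrite muleCA.
  rewrite ge0_integralZl//.
  - by apply: measurable_econv_integrand => //; exact: measurable_econv.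
  - by move=> y _; rewrite mule_ge0// econv_ge0.
  - by rewrite lee_fin invr_ge0 ltW.
rewrite econvA//.
have -> : (econv (econv (EFin \o rlker s) (EFin \o rlker t)) (EFin \o f) x =
   ebeta s t * econv (EFin \o rlker (s + t)) (EFin \o f) x)%E.
  rewrite {1}/econv.
  under eq_integral do rewrite econv_rlker -muleA.
  rewrite ge0_integralZl//.
  - exact: (measurable_econv_integrand _ _ x (mk (s + t)) mf).
  - by move=> y _; rewrite mule_ge0// lee_fin// rlker_ge0.
  - exact: ebeta_ge0.
rewrite ebetaE// !muleA; congr (_ * _)%E; rewrite -!EFinM; congr EFin.
by field; rewrite !gt_eqF.
Qed.

Lemma fracint_semigroup s t f : 0 < s -> 0 < t -> causal f ->
  fracint s (fracint t f) = fracint (s + t) f.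
Proof.
move=> s0 t0 cf; have st0 := addr_gt0 s0 t0.
have cp := causal_funrpos _ cf; have cn := causal_funrneg _ cf.
rewrite (funrpos_neg f) !fracintB//; [|exact: causal_fracint..].
by rewrite !fracint_semigroup_ge0.
Qed.

End semigroup.

(** * Fractional integrals on [E]: regularity and commutation with derivatives *)

Section fracint_E.
Context {R : realType}.
Local Notation mu := (@lebesgue_measure R).
Implicit Types (s t x y a b : R) (f g h : R -> R) (n : nat).

Lemma derivable1_continuous f x : derivable f x 1 -> {for x, continuous f}.
Proof. by move=> /derivable1_diffP/differentiable_continuous. Qed.

Lemma E_continuous f : E f -> continuous f.
Proof.
by move=> [df _] x; apply: derivable1_continuous; exact: (df 0%N x).
Qed.

Lemma E_derive1 f : E f -> E (derive1 f).
Proof.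
move=> [df f0]; split=> n x; rewrite -derive1Sn; first exact: df.
exact: f0.
Qed.

Lemma E_derive1n n f : E f -> E (derive1n n f).
Proof.
by move=> Ef; elim: n => [|n IHn]; [|rewrite derive1nS; exact: E_derive1].
Qed.

(** The bound on a half-line reduces to the extreme value theorem on [[0, b]]. *)
Lemma continuous_causal f : continuous f -> (forall x, x <= 0 -> f x = 0) ->
  causal f.
Proof.
move=> cf f0; split => //; first exact: continuous_measurable_fun.
move=> b; have [b0|b0] := leP b 0.
  by exists 0 => y yb; rewrite f0 ?normr0// (le_trans yb).
have cnf : {within `[0, b], continuous (fun x => `|f x|)}.
  apply: continuous_subspaceT => x; apply: continuous_comp; first exact: cf.
  exact: norm_continuous.
have [c _ hc] := EVT_max (ltW b0) cnf.
exists `|f c| => y yb; have [y0|y0] := leP y 0; first by rewrite f0// normr0.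
by apply: hc; rewrite in_itv/= yb ltW.
Qed.

Lemma E_causal f : E f -> causal f.
Proof.
move=> Ef; apply: continuous_causal; first exact: E_continuous.
exact: (Ef.2 0%N).
Qed.

(** The free base point [a] allows [x] to be interior to the integration range even when
    [x <= 0]. *)
Lemma fracint1E g a x : causal g -> a <= 0 ->
  fracint 1 g x = \int[mu]_(y in `[a, x]) g y.
Proof.
move=> cg a0; have [mg g0 _] := cg.
rewrite fracintE// Gamma1 invr1 mul1r; congr fine.
rewrite -[RHS]integral_itv_bndo_bndc; last first.
  by apply: measurable_funTS; apply/measurable_EFinP.
rewrite [RHS]integral_mkcond; apply: eq_integral => y _.
rewrite patchE mem_setE in_itv/= /rlker subr_gt0 subrr powRr0.
have [ay/=|ya/=] := leP a y; first by case: ifP; rewrite ?mul0r ?mul1r.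
by rewrite g0 ?mulr0// (le_trans (ltW ya)).
Qed.

Lemma causal_integrable g a b : causal g ->
  mu.-integrable `[a, b] (EFin \o g).
Proof.
move=> [mg _ /(_ b)[M hM]]; apply: measurable_bounded_integrable => //.
- by rewrite /= lebesgue_measure_itv/=; case: ifP; rewrite -?EFinB ltry.
- exact: measurable_funTS.
exists M; split; first exact: num_real.
move=> r Mr y /=; rewrite in_itv/= => /andP[_ yb].
by rewrite (le_trans (hM _ yb))// ltW.
Qed.

Lemma continuous_fracint1 g : causal g -> continuous (fracint 1 g).
Proof.
move=> cg x.
(* [a] lies below both [x] and [0], so [fracint1E] applies and [x] is interior to [[a, b]]. *)
pose a := Num.min x 0 - 1; pose b := x + 1.
have ax : a < x by rewrite /a ltrBlDr gt_min ltrDl ltr01.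
have a0 : a <= 0 by rewrite /a lerBlDr ge_min lerDl ler01 orbT.
have xb : x < b by rewrite /b ltrDl.
have -> : fracint 1 g = (fun x => \int[mu]_(y in `[a, x]) g y).
  by apply/funext => y; exact: fracint1E.
have ab := lt_trans ax xb.
have := @parameterized_integral_continuous R a b g (ltW ab)
  (causal_integrable g a b cg).
move=> /(continuous_within_itvP _ ab)[/(_ x) + _ _].
by apply; rewrite in_itv/= ax.
Qed.

Lemma derive_fracint1 g x : causal g -> {for x, continuous g} ->
  derivable (fracint 1 g) x 1 /\ derive1 (fracint 1 g) x = g x.
Proof.
move=> cg cgx.
pose a := Num.min x 0 - 1; pose b := x + 1.
have ax : a < x by rewrite /a ltrBlDr gt_min ltrDl ltr01.
have a0 : a <= 0 by rewrite /a lerBlDr ge_min lerDl ler01 orbT.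
have xb : x < b by rewrite /b ltrDl.
have -> : fracint 1 g = (fun x => \int[mu]_(y in `[a, x]) g y).
  by apply/funext => y; exact: fracint1E.
exact: (continuous_FTC1_closed xb (causal_integrable g a b cg) ax cgx).
Qed.

Lemma fracint1_derive1 f : E f -> fracint 1 (derive1 f) = f.
Proof.
move=> Ef; apply/funext => x.
have f0 y : y <= 0 -> f y = 0 by exact: (Ef.2 0%N).
have df y : derivable f y 1 by exact: (Ef.1 0%N).
have Ef' := E_derive1 _ Ef.
have [x0|x0] := leP x 0; first by rewrite fracint_le0// f0.
rewrite (fracint1E _ 0)//; last exact: E_causal.
rewrite /Rintegral (@continuous_FTC2 _ _ f)//.
- by rewrite (f0 0)// sube0.
- by apply: continuous_subspaceT; exact: E_continuous.
split.
- by move=> y _; exact: df.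
- by apply: cvg_at_right_filter; exact: derivable1_continuous.
- by apply: cvg_at_left_filter; exact: derivable1_continuous.
Qed.

(** By the semigroup law, [J^s f = J^s J^1 f' = J^1 J^s f']; the outer [J^1] supplies the regularity
    used below. *)
Lemma fracint_fracint1 s f : 0 < s -> E f ->
  fracint s f = fracint 1 (fracint s (derive1 f)).
Proof.
move=> s0 Ef; have cf' := E_causal _ (E_derive1 _ Ef).
by rewrite -{1}(fracint1_derive1 _ Ef) !fracint_semigroup// addrC.
Qed.

Lemma continuous_fracint s f : 0 < s -> E f -> continuous (fracint s f).
Proof.
move=> s0 Ef; rewrite fracint_fracint1//; apply: continuous_fracint1.
by apply: causal_fracint => //; exact/E_causal/E_derive1.
Qed.

Lemma derive_fracint s f x : 0 < s -> E f ->
  derivable (fracint s f) x 1 /\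
  derive1 (fracint s f) x = fracint s (derive1 f) x.
Proof.
move=> s0 Ef; rewrite (fracint_fracint1 _ _ s0 Ef).
apply: derive_fracint1.
  by apply: causal_fracint => //; exact/E_causal/E_derive1.
by apply: continuous_fracint => //; exact: E_derive1.
Qed.

Lemma derive1n_fracint s n f : 0 < s -> E f ->
  derive1n n (fracint s f) = fracint s (derive1n n f).
Proof.
move=> s0 Ef; elim: n => // n IHn; rewrite !derive1nS IHn.
by apply/funext => x; have [] := derive_fracint s _ x s0 (E_derive1n n _ Ef).
Qed.

Lemma E_fracint s f : 0 < s -> E f -> E (fracint s f).
Proof.
move=> s0 Ef; split=> n x; rewrite derive1n_fracint//.
  by have [] := derive_fracint s _ x s0 (E_derive1n n _ Ef).
exact: fracint_le0.
Qed.

(** Induction inserting [J^1 D = 1] in the middle: [J^n D^n = J^n (J^1 D) D^n = J^(n+1) D^(n+1)]. *)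
Lemma fracint_nat_derive1n n f : (0 < n)%N -> E f ->
  fracint n%:R (derive1n n f) = f.
Proof.
case: n => // n _; elim: n f => [|n IHn] f Ef; first exact: fracint1_derive1.
have En := E_derive1n n.+1 _ Ef.
rewrite -[in RHS](IHn f Ef) -[in RHS](fracint1_derive1 _ En).
rewrite fracint_semigroup//.
  by rewrite natr1 derive1nS.
exact/E_causal/E_derive1.
Qed.

End fracint_E.

(** * Stability of [E] and the two inverse identities *)

Theorem theorem3 (R : realType) (s : R) (hs : 0 < s)
    (k : nat) (hk : s < k%:R) :
  [/\ forall f : R -> R, E f -> E (fracint s f),
      forall f : R -> R, E f -> E (fracder k s f),
      forall f : R -> R, E f -> fracder k s (fracint s f) = f &
      forall f : R -> R, E f -> fracint s (fracder k s f) = f].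
Proof.
have ks0 : 0 < k%:R - s by rewrite subr_gt0.
have k0 : (0 < k)%N by rewrite -(ltr_nat R) (lt_trans hs).
have sE : s \is a Num.nat -> exists2 n, (0 < n)%N & s = n%:R.
  by move=> /natrP[n sn]; exists n => //; rewrite -(ltr_nat R) -sn.
split=> f Ef.
- exact: E_fracint.
- rewrite /fracder; case: ifPn => _; first exact: E_derive1n.
  by apply: E_derive1n; exact: E_fracint.
- rewrite /fracder; case: ifPn => [/sE[n n0 ->]|_].
    by rewrite natrK derive1n_fracint ?ltr0n// fracint_nat_derive1n.
  (* The orders [k - s] and [s] add up to [k], leaving [D^k J^k = J^k D^k]. *)
  rewrite fracint_semigroup//; last exact: E_causal.
  by rewrite subrK derive1n_fracint ?ltr0n// fracint_nat_derive1n.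
- rewrite /fracder; case: ifPn => [/sE[n n0 ->]|_].
    by rewrite natrK fracint_nat_derive1n.
  (* Moving [D^k] inside [J^(k-s)] puts the two integrals side by side, with total order [k]. *)
  rewrite derive1n_fracint// fracint_semigroup//; last first.
    exact/E_causal/E_derive1n.
  by rewrite subrKC fracint_nat_derive1n.
Qed.
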